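(* There is no non-flat $(2n+1)$-dimensional locally $\phi$-recurrent contact metric manifold of constant curvature. That is, no contact metric manifold $M^{2n+1}(\phi,\xi,\eta,g)$ whose metric $g$ has constant curvature $c\neq 0$ is locally $\phi$-recurrent.
   Context: A contact metric manifold $M^{2n+1}(\phi,\xi,\eta,g)$ is a differentiable $(2n+1)$-dimensional manifold with a global 1-form $\eta$ satisfying $\eta\wedge(d\eta)^n\neq 0$ everywhere, a global vector field $\xi$, a $(1,1)$-tensor field $\phi$ and a Riemannian metric $g$ such that $\eta(\xi)=1$, $\phi^2=-\mathrm{Id}+\eta\otimes\xi$, $g(\phi X,\phi Y)=g(X,Y)-\eta(X)\eta(Y)$ and $d\eta(X,Y)=g(X,\phi Y)$ for all vector fields $X,Y$, with the convention $d\eta(X,Y)=\frac12\big(X\eta(Y)-Y\eta(X)-\eta([X,Y])\big)$. Let $\nabla$ be the Riemannian (Levi-Civita) connection of $g$ and $R(X,Y)Z=\nabla_X\nabla_YZ-\nabla_Y\nabla_XZ-\nabla_{[X,Y]}Z$ its curvature tensor. Constant curvature $c$ means $R(X,Y)Z=c(g(Y,Z)X-g(X,Z)Y)$ for all vector fields $X,Y,Z$; non-flat then means $c\neq 0$. A contact metric manifold is locally $\phi$-recurrent if there exists a non-zero 1-form $A$ on $M$ such that $\phi^2((\nabla_WR)(X,Y)Z)=A(W)R(X,Y)Z$ for all vector fields $W,X,Y,Z$ orthogonal to $\xi$.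
   Formalization: The 1-form A in ''locally φ-recurrent'' is required to be non-zero on some vector field orthogonal to ξ, not merely non-zero on M; otherwise A = η makes the unit sphere (constant curvature 1) a counterexample. *)

(* Defs.v *)
From HB Require Import structures.
From mathcomp Require Import all_boot all_order all_algebra all_fingroup.
From mathcomp Require Import ring.
From mathcomp Require Import all_classical all_reals all_analysis.

Set Implicit Arguments.
Unset Strict Implicit.
Unset Printing Implicit Defensive.
Import Order.TTheory GRing.Theory Num.Theory.
Import numFieldNormedType.Exports.
Local Open Scope classical_set_scope.
Local Open Scope ring_scope.

Section Smoothness.
Context {R : realType} {V W : normedModType R}.

(* The directional derivatives are taken in every direction v, so that for
   V = 'rV[R]_m this is the usual definition through iterated partials. *)
Fixpoint Ck (k : nat) (U : set V) (f : V -> W) : Prop :=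
  (forall x, U x -> {for x, continuous f}) /\
  if k is k'.+1 then
    forall v, (forall x, U x -> derivable f x v) /\ Ck k' U ('D_v f)
  else True.

Definition Cinf (U : set V) (f : V -> W) : Prop := forall k, Ck k U f.

End Smoothness.

Section SmoothnessTheory.
Context {R : realType} {V : normedModType R}.
Implicit Types (U : set V) (f g : V -> R).

Lemma Ck_cont k U f : Ck k U f -> forall x, U x -> {for x, continuous f}.
Proof. by case: k => [|k] []. Qed.

Lemma CkS k U f : Ck k.+1 U f -> Ck k U f.
Proof.
elim: k f => [|k IH] f; first by case.
case=> fc fd; split=> // v; have [dv cv] := fd v; split=> //.
exact: IH.
Qed.

Lemma Ck_ext k U f g : open U -> {in U, f =1 g} -> Ck k U f -> Ck k U g.
Proof.
move=> oU; have near_fg f' g' x : {in U, f' =1 g'} -> U x ->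
    \forall y \near x, f' y = g' y.
  move=> fg Ux; apply: filterS (open_nbhs_nbhs (conj oU Ux)) => y Uy.
  by apply: fg; rewrite inE.
elim: k f g => [|k IH] f g fg [fc fd]; split=> //.
- move=> x Ux; apply: cvg_trans (_ : f @ x --> _).
    exact: near_eq_cvg (near_fg _ _ _ fg Ux).
  by rewrite -fg ?inE//; exact: fc.
- move=> x Ux; apply: cvg_trans (_ : f @ x --> _).
    exact: near_eq_cvg (near_fg _ _ _ fg Ux).
  by rewrite -fg ?inE//; exact: fc.
- move=> v; have [dv cv] := fd v; split.
    move=> x Ux; apply: near_eq_derivable (dv x Ux).
    exact: near_fg.
  apply: IH cv => x; rewrite inE => Ux; apply: near_eq_derive.
  exact: near_fg.
Qed.

Lemma Ck_cst k U (c : R) : Ck k U (cst c).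
Proof.
elim: k c => [|k IH] c; split=> //; try by move=> x _; exact: cvg_cst.
move=> v; split=> [x _|]; first exact: derivable_cst.
rewrite (_ : 'D_v _ = cst 0); first exact: IH.
by apply/funext => x; exact: derive_cst.
Qed.

Lemma CkD k U f g : open U -> Ck k U f -> Ck k U g -> Ck k U (f + g).
Proof.
move=> oU; elim: k f g => [|k IH] f g [fc fd] [gc gd]; split=> //;
  try by move=> x Ux; apply: cvgD; [exact: fc | exact: gc].
move=> v; have [df cf] := fd v; have [dg cg] := gd v; split.
  by move=> x Ux; apply: derivableD; [exact: df | exact: dg].
apply: (@Ck_ext _ _ ('D_v f + 'D_v g)) => //; last exact: IH.
by move=> x; rewrite inE => Ux; rewrite deriveD//; [exact: df | exact: dg].
Qed.

Lemma CkM k U f g : open U -> Ck k U f -> Ck k U g -> Ck k U (f * g).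
Proof.
move=> oU; elim: k f g => [|k IH] f g Cf Cg; split=> //;
  try by move=> x Ux; apply: cvgM; [exact: (Ck_cont Cf) | exact: (Ck_cont Cg)].
case: (Cf) (Cg) => _ fd [_ gd].
move=> v; have [df cf] := fd v; have [dg cg] := gd v; split.
  by move=> x Ux; apply: derivableM; [exact: df | exact: dg].
apply: (@Ck_ext _ _ (f * 'D_v g + g * 'D_v f)) => //.
  by move=> x; rewrite inE => Ux; rewrite deriveM//; [exact: df | exact: dg].
by apply: CkD => //; apply: IH => //; exact: CkS.
Qed.

End SmoothnessTheory.

Section Manifold.
Context (R : realType) (m : nat).

Record chart (T : topologicalType) := Chart {
  cdom : set T;
  cmap : T -> 'rV[R]_m;
  cinv : 'rV[R]_m -> T;
  cdom_open : open cdom;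
  cimg_open : open (cmap @` cdom);
  cmapK : {in cdom, cancel cmap cinv};
  cmap_cont : forall p, cdom p -> {for p, continuous cmap};
  cinv_cont : forall x, (cmap @` cdom) x -> {for x, continuous cinv} }.

Record manifold := Manifold {
  carrier :> topologicalType;
  atlas : set (chart carrier);
  carrier_hausdorff : hausdorff_space carrier;
  carrier_second_countable : @second_countable carrier;
  atlas_cover : forall p : carrier, exists2 a, atlas a & cdom a p;
  atlas_smooth : forall a b, atlas a -> atlas b ->
    Cinf (cmap a @` (cdom a `&` cdom b)) (cmap b \o cinv a) }.

Definition smooth (M : manifold) : {pred M -> R} :=
  mem [set f : M -> R | forall a, atlas a ->
                          Cinf (cmap a @` cdom a) (f \o cinv a)].

Lemma smooth_subring_closed (M : manifold) : subring_closed (@smooth M).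
Proof.
have smoothM (f g : M -> R) :
    f \in @smooth M -> g \in @smooth M -> f * g \in @smooth M.
  rewrite !inE => sf sg a Aa k; apply: (@CkM _ _ _ _ (f \o _) (g \o _)).
  - exact: cimg_open.
  - exact: sf.
  - exact: sg.
have smooth_cst c : cst c \in @smooth M.
  by rewrite inE => a Aa k; exact: Ck_cst.
split=> // [|f g sf sg]; first exact: smooth_cst 1.
rewrite (_ : f - g = f + cst (-1) * g); last first.
  by apply/funext => p; rewrite !fctE mulN1r.
move: (smoothM _ _ (smooth_cst (-1)) sg) sf.
rewrite !inE => sg' sf a Aa k.
apply: (@CkD _ _ _ _ (f \o _) ((cst (-1) * g) \o _)).
- exact: cimg_open.
- exact: sf.
- exact: sg'.
Qed.

HB.instance Definition _ (M : manifold) :=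
  GRing.isSubringClosed.Build _ (@smooth M) (smooth_subring_closed M).

Lemma smooth_scaler_closed (M : manifold) :
  GRing.scaler_closed (@smooth M : {pred M -> R^o}).
Proof.
move=> c f sf; rewrite (_ : c *: f = (cst c : M -> R) * f)//.
by apply: rpredM => //; rewrite inE => a Aa k; exact: Ck_cst.
Qed.

Record scalarField (M : manifold) := ScalarField {
  sfun :> M -> R;
  sfunP : sfun \in @smooth M }.

HB.instance Definition _ (M : manifold) := [isSub for (@sfun M)].
HB.instance Definition _ (M : manifold) := [Choice of scalarField M by <:].
HB.instance Definition _ (M : manifold) :=
  GRing.SubChoice_isSubComPzRing.Build _ _ (scalarField M)
    (smooth_subring_closed M).
HB.instance Definition _ (M : manifold) :=
  GRing.isScaleClosed.Build _ _ (@smooth M : {pred M -> R^o})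
    (@smooth_scaler_closed M).
HB.instance Definition _ (M : manifold) :=
  GRing.SubZmodule_isSubLmodule.Build R (M -> R^o) (@smooth M) (scalarField M)
    (GRing.subsemimodClosedP _).

(* A smooth vector field is identified with the derivation of the algebra of
   smooth functions it induces. *)
Definition derivation (M : manifold) :
    {pred scalarField M -> (scalarField M)^o} :=
  mem [set X : scalarField M -> scalarField M |
    [/\ forall f h, X (f + h) = X f + X h,
        forall (c : R) f, X (c *: f) = c *: X f
      & forall f h, X (f * h) = X f * h + f * X h]].

Lemma derivation_submod_closed (M : manifold) :
  submod_closed (@derivation M).
Proof.
have addE (X Y : scalarField M -> (scalarField M)^o) h :
  (X + Y) h = X h + Y h :> scalarField M by [].
have scaleE f (X : scalarField M -> (scalarField M)^o) h :
  (f *: X) h = f * X h :> scalarField M by [].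
split=> [|f X Y].
  rewrite inE; split=> [f h|c f|f h]; rewrite /GRing.zero /=.
  - by rewrite addr0.
  - by rewrite scaler0.
  - by rewrite mul0r mulr0 addr0.
rewrite !inE => -[XD XZ XM] [YD YZ YM].
split=> [h k|c h|h k]; rewrite !addE !scaleE.
- by rewrite XD YD; ring.
- rewrite XZ YZ scalerDr; congr (_ + _).
  by apply: val_inj; apply/funext => p; exact: mulrCA.
- by rewrite XM YM; ring.
Qed.

Record vectorField (M : manifold) := VectorField {
  vfun :> scalarField M -> (scalarField M)^o;
  vfunP : vfun \in @derivation M }.

HB.instance Definition _ (M : manifold) := [isSub for (@vfun M)].
HB.instance Definition _ (M : manifold) := [Choice of vectorField M by <:].
HB.instance Definition _ (M : manifold) :=
  GRing.isSubmodClosed.Build _ _ (@derivation M) (@derivation_submod_closed M).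
HB.instance Definition _ (M : manifold) :=
  [SubChoice_isSubLmodule of vectorField M by <:].

Section VectorFields.
Context (M : manifold).
Local Notation C := (scalarField M).
Local Notation VF := (vectorField M).
Implicit Types (U V : VF) (f h : C).

Definition vanishes_at U (p : M) := forall f : C, (U f : C) p = 0.

Lemma vfunD U f h : U (f + h) = U f + U h :> C.
Proof. by case: U => U /= /[!inE] -[]. Qed.

Lemma vfunZ U (a : R) f : U (a *: f) = a *: (U f : C) :> C.
Proof. by case: U => U /= /[!inE] -[]. Qed.

Lemma vfunM U f h : U (f * h) = (U f : C) * h + f * (U h : C) :> C.
Proof. by case: U => U /= /[!inE] -[]. Qed.

Lemma lie_derivation U V :
  (fun f => U (V f) - V (U f)) \in @derivation M.
Proof.
rewrite inE; split=> [f h|a f|f h].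
- by rewrite !vfunD; ring.
- by rewrite !vfunZ scalerBr.
- by rewrite !vfunM !vfunD !vfunM; ring.
Qed.

Definition lie U V : VF := VectorField (lie_derivation U V).

End VectorFields.

Section Tensors.
Context (M : manifold).
Local Notation C := (scalarField M).
Local Notation VF := (vectorField M).

(* Tensor fields are maps on vector fields that are linear over the smooth
   functions in each argument. Differential forms are given by their values on
   tuples of vector fields; the factor 1/(k+l)! in the wedge product goes with
   the factor 1/2 in the exterior derivative. *)
Definition form k := ('I_k -> VF) -> C.

Definition form1 (a : {scalar VF}) : form 1 := fun U => a (U ord0).

Definition d1 (a : {scalar VF}) (U V : VF) : C :=
  (2^-1 : R) *: (U (a V) - V (a U) - a (lie U V) : C).

Definition form2 (b : VF -> VF -> C) : form 2 := fun U => b (U ord0) (U ord_max).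

Definition wedge k l (a : form k) (b : form l) : form (k + l) := fun U =>
  ((k + l)`!%:R^-1 : R) *: \sum_(s : 'S_(k + l)) (-1) ^+ s *
    (a (fun i => U (s (lshift l i))) * b (fun j => U (s (rshift k j)))).

Fixpoint wedge_exp (b : form 2) (n : nat) : form (n * 2) :=
  if n is n'.+1 then wedge b (@wedge_exp b n') else fun=> 1.

Definition nowhere_zero k (a : form k) := forall p : M, exists U, a U p <> 0.

Record riemannian_metric := RiemannianMetric {
  metric :> VF -> VF -> C;
  metricC : forall U V : VF, metric U V = metric V U;
  metric_linear : forall (f : C) (U V W : VF),
    metric (f *: U + V) W = f * metric U W + metric V W;
  metric_gt0 : forall (U : VF) (p : M), ~ vanishes_at U p -> 0 < metric U U p }.

Record levi_civita (g : riemannian_metric) (nabla : VF -> VF -> VF) : Prop := {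
  nabla_linear : forall (f : C) (U V Z : VF),
    nabla (f *: U + V) Z = f *: nabla U Z + nabla V Z;
  nablaD : forall (U Y Z : VF), nabla U (Y + Z) = nabla U Y + nabla U Z;
  nabla_leibniz : forall (U : VF) (f : C) (Y : VF),
    nabla U (f *: Y) = (U f : C) *: Y + f *: nabla U Y;
  nabla_torsion_free : forall U V : VF, nabla U V - nabla V U = lie U V;
  nabla_metric : forall (U Y Z : VF),
    U (g Y Z) = g (nabla U Y) Z + g Y (nabla U Z) :> C }.

Definition curvature (nabla : VF -> VF -> VF) (U V Z : VF) : VF :=
  nabla U (nabla V Z) - nabla V (nabla U Z) - nabla (lie U V) Z.

Definition nabla_curvature (nabla : VF -> VF -> VF) (W U V Z : VF) : VF :=
  let T := curvature nabla in
  nabla W (T U V Z) - T (nabla W U) V Z - T U (nabla W V) Z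
    - T U V (nabla W Z).

Definition constant_curvature (g : riemannian_metric) nabla (c : R) :=
  forall U V Z : VF, curvature nabla U V Z =
    (c *: g V Z) *: U - (c *: g U Z) *: V.

End Tensors.

End Manifold.

Section ContactMetric.
Context (R : realType) (n : nat) (M : manifold R (2 * n).+1).
Local Notation VF := (vectorField M).
Implicit Types (phi : {linear VF -> VF}) (xi : VF) (eta : {scalar VF}).
Implicit Types (g : riemannian_metric M) (nabla : VF -> VF -> VF).

Record contact_metric phi xi eta g : Prop := {
  contact_form :
    nowhere_zero (wedge (form1 eta) (wedge_exp (form2 (d1 eta)) (n := n)));
  contact_reeb : eta xi = 1;
  contact_phi2 : forall U : VF, phi (phi U) = - U + eta U *: xi;
  contact_gphi : forall U V : VF, g (phi U) (phi V) = g U V - eta U * eta V;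
  contact_deta : forall U V : VF, d1 eta U V = g U (phi V) }.

(* The identity only involves A on the contact distribution, so A is required
   to be non-zero there. If A were merely non-zero as a form, A = eta would make
   every locally symmetric contact metric manifold, e.g. the unit sphere
   S^(2n+1), locally phi-recurrent. *)
Definition locally_phi_recurrent phi xi g nabla :=
  exists A : {scalar VF},
    (exists W : VF, g W xi = 0 /\ A W <> 0) /\
    forall W U V Z : VF, g W xi = 0 -> g U xi = 0 -> g V xi = 0 -> g Z xi = 0 ->
      phi (phi (nabla_curvature nabla W U V Z)) =
      A W *: curvature nabla U V Z.

End ContactMetric.

(* Main.v *)
Require Import Defs.
From HB Require Import structures.
From mathcomp Require Import all_boot all_order all_algebra.
From mathcomp Require Import ring.
From mathcomp Require Import all_classical all_reals all_analysis.
Import Order.TTheory GRing.Theory Num.Theory.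
Local Open Scope ring_scope.

(** A metric of constant curvature is locally symmetric: its curvature is built
    from g alone, so nabla g = 0 gives nabla R = 0 (nabla_curvature_eq0).
    Phi-recurrence then reads A(W) R(X,Y)Z = 0 on the contact distribution.

    Suppose W is orthogonal to xi. Then phi W is orthogonal to both xi and W,
    and has the same length as W; so W and phi W span a plane of the contact
    distribution wherever W does not vanish. Taking X = Z = W and Y = phi W,
    constant curvature gives R(W, phi W)W = - c g(W,W) phi W, and the inner
    product of the recurrence identity with phi W becomes
    c A(W) g(W,W)^2 = 0. As c <> 0 and g is definite, at each point either A(W)
    is 0 or W vanishes; hence the vector field A(W) W is identically 0.
    Applying the 1-form A to it, A(W)^2 = 0, so A vanishes on the contact
    distribution, against the non-triviality of A.

    Vector fields are derivations, so vanishing at a point is tested on all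
    smooth functions, and a local frame is never needed: the plane spanned by
    W and phi W replaces any dimension count. *)

Section Metric.
Context {R : realType} {m : nat} {M : manifold R m}.
Local Notation C := (scalarField M).
Local Notation VF := (vectorField M).
Implicit Types (f : C) (U V W : VF) (g : riemannian_metric M).

(** Smooth functions have zero divisors, but they form a reduced ring since
    their values lie in a field. *)
Lemma scalarField_sqr_eq0 f : f * f = 0 -> f = 0.
Proof.
move=> ff0; apply: val_inj; apply/funext => p.
have /eqP : (f * f : C) p = 0 by rewrite ff0.
by rewrite -[(f * f : C) p]/(f p * f p) mulf_eq0 orbb => /eqP.
Qed.

Lemma metric0l g V : g 0 V = 0.
Proof.
have /(congr1 (fun f => f - g 0 V)) := metric_linear g 1 0 0 V.
by rewrite scaler0 addr0 mul1r addrK subrr.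
Qed.

Lemma metricZl g f U V : g (f *: U) V = f * g U V.
Proof. by have := metric_linear g f U 0 V; rewrite metric0l !addr0. Qed.

(** Definiteness at the points where f is non-zero. Pointwise reasoning replaces
    a cancellation by g(U,U), which may have zeros. *)
Lemma metric_definite_scale g f U : f * (g U U * g U U) = 0 -> f *: U = 0.
Proof.
move=> fgg0; apply: val_inj; apply/funext => h.
apply: val_inj; apply/funext => p.
have : (f * (g U U * g U U) : C) p = 0 by rewrite fgg0.
rewrite -[LHS]/(f p * (g U U p * g U U p)) => /eqP.
rewrite !mulf_eq0 orbb => /orP fg0.
change (f p * (U h : C) p = 0).
case: fg0 => [/eqP ->|/eqP gU0]; first by rewrite mul0r.
suff -> : (U h : C) p = 0 by rewrite mulr0.
have [U0|/(metric_gt0 g)] := pselect (vanishes_at U p); first exact: U0.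
by rewrite gU0 ltxx.
Qed.

End Metric.

Section ConstantCurvature.
Context {R : realType} {m : nat} {M : manifold R m}.
Context {g : riemannian_metric M}.
Context {nabla : vectorField M -> vectorField M -> vectorField M} {c : R}.
Hypothesis LC : levi_civita g nabla.
Local Notation C := (scalarField M).
Local Notation VF := (vectorField M).

Lemma nablaB (W U V : VF) : nabla W (U - V) = nabla W U - nabla W V.
Proof. by apply/eqP; rewrite eq_sym subr_eq -(nablaD LC) subrK. Qed.

(** The Leibniz rule and metric compatibility turn nabla_W of
    c g(V,Z) U - c g(U,Z) V into the sum of the same expression with nabla_W
    applied to each of U, V and Z in turn, which is what the correction terms
    of nabla R subtract. *)
Lemma nabla_curvature_eq0 (W U V Z : VF) :
  constant_curvature g nabla c -> nabla_curvature nabla W U V Z = 0.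
Proof.
move=> cc; rewrite /nabla_curvature !cc nablaB !(nabla_leibniz LC).
rewrite !vfunZ !(nabla_metric LC) !scalerDr.
(* Evaluated on a function, this is an identity in the ring of functions. *)
apply: val_inj; apply/funext => h.
set a := (c *: g V Z : C); set b := (c *: g U Z : C).
set a1 := (c *: g (nabla W V) Z : C); set a2 := (c *: g V (nabla W Z) : C).
set b1 := (c *: g (nabla W U) Z : C); set b2 := (c *: g U (nabla W Z) : C).
set U' := nabla W U; set V' := nabla W V.
change (((a1 + a2) * (U h : C) + a * (U' h : C)
  - ((b1 + b2) * (V h : C) + b * (V' h : C))
  - (a * (U' h : C) - b1 * (V h : C))
  - (a1 * (U h : C) - b * (V' h : C))
  - (a2 * (U h : C) - b2 * (V h : C)) : C) = 0).
by ring.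
Qed.

End ConstantCurvature.

Section ContactMetricTheory.
Context {R : realType} {n : nat} {M : manifold R (2 * n).+1}.
Context {phi : {linear vectorField M -> vectorField M}} {xi : vectorField M}.
Context {eta : {scalar vectorField M}} {g : riemannian_metric M}.
Hypothesis CM : contact_metric phi xi eta g.
Local Notation C := (scalarField M).
Local Notation VF := (vectorField M).

Lemma eta_scale_xi (f : C) : eta (f *: xi) = f.
Proof. by rewrite linearZ /= (contact_reeb CM) -[RHS]mulr1. Qed.

(** Computing phi^3 xi in two ways gives phi xi = f xi with f = eta (phi xi),
    hence f^2 xi = phi^2 xi = 0. *)
Lemma phi_xi : phi xi = 0.
Proof.
have phi2xi : phi (phi xi) = 0.
  by rewrite (contact_phi2 CM) (contact_reeb CM) scale1r addNr.
have phixiE : phi xi = eta (phi xi) *: xi.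
  have := contact_phi2 CM (phi xi); rewrite phi2xi linear0 => /esym/eqP.
  by rewrite addrC subr_eq0 => /eqP/esym.
rewrite phixiE [eta _]scalarField_sqr_eq0 ?scale0r//.
rewrite -[LHS]eta_scale_xi -scalerA -phixiE.
by rewrite -linearZ /= -phixiE phi2xi linear0.
Qed.

Lemma metric_xi (U : VF) : g U xi = eta U.
Proof.
have := contact_gphi CM U xi.
rewrite phi_xi metricC metric0l (contact_reeb CM) mulr1 => /esym/eqP.
by rewrite subr_eq0 => /eqP.
Qed.

(** Both sides of phi (phi^2 U) = phi^2 (phi U) equal - phi U up to a multiple
    of xi, which is eta (phi U) xi on the right and eta U phi xi = 0 on the
    left. *)
Lemma eta_phi (U : VF) : eta (phi U) = 0.
Proof.
have := contact_phi2 CM (phi U).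
rewrite (contact_phi2 CM U) linearD linearN linearZ /= phi_xi scaler0 => /addrI.
by move=> phiU; rewrite -[LHS]eta_scale_xi -phiU linear0.
Qed.

(** g(U, phi U) is d eta (U, U), and d eta is alternating. *)
Lemma metric_phi_self (U : VF) : g U (phi U) = 0.
Proof.
rewrite -(contact_deta CM) /d1 subrr.
have -> : lie U U = 0.
  by apply: val_inj; apply/funext => f; exact: subrr.
by rewrite linear0 subrr scaler0.
Qed.

End ContactMetricTheory.

Theorem theorem4p15 (R : realType) (n : nat) (M : manifold R (2 * n).+1)
    (phi : {linear vectorField M -> vectorField M}) (xi : vectorField M)
    (eta : {scalar vectorField M}) (g : riemannian_metric M)
    (nabla : vectorField M -> vectorField M -> vectorField M) (c : R) :
  contact_metric phi xi eta g ->
  levi_civita g nabla ->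
  constant_curvature g nabla c ->
  c <> 0 ->
  ~ locally_phi_recurrent phi xi g nabla.
Proof.
move=> CM LC cc c0 [A [[W [Wxi AW0]] rec]]; apply: AW0.
have etaW : eta W = 0 by rewrite -(metric_xi CM).
have phiWxi : g (phi W) xi = 0 by rewrite (metric_xi CM) (eta_phi CM).
have phiW_norm : g (phi W) (phi W) = g W W.
  by rewrite (contact_gphi CM) etaW mulr0 subr0.
have := rec W W (phi W) W Wxi Wxi phiWxi Wxi.
rewrite (nabla_curvature_eq0 LC _ _ _ _ cc) !linear0 cc.
rewrite (metricC g (phi W)) (metric_phi_self CM) scaler0 scale0r sub0r.
rewrite scalerN => /esym/eqP; rewrite oppr_eq0 => /eqP.
rewrite scalerA => /(congr1 (g^~ (phi W))).
rewrite metricZl metric0l phiW_norm => AWgg.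
have AWW : A W *: W = 0.
  apply: (@metric_definite_scale _ _ _ g).
  apply: (scalerI (introN eqP c0)); rewrite scaler0 -[RHS]AWgg.
  apply: val_inj; apply/funext => p.
  change (c * (A W p * (g W W p * g W W p)) =
          A W p * (c * g W W p) * g W W p).
  by ring.
apply: scalarField_sqr_eq0.
by have := congr1 A AWW; rewrite linearZ linear0.
Qed.
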